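(* Let $\alpha=(\alpha_n)_{n\in\mathbb{N}}\subset(0,1)$ be a nonincreasing sequence and let $\mu_\alpha$ be the uniform measure on the Cantor set $C(\alpha)$. Assume that $\lim_{n \to \infty} \alpha_n = 0$. Then, for every $p\in[1,\infty)$, $$\limsup_{h \searrow 0} \frac{W_p(\mu_{\alpha},\mu_{\alpha,h})}{h} = 0.$$
   Context: For a bounded interval $I\subset\mathbb{R}$ and $a\in(0,1)$, $a * I$ denotes the interval with the same center as $I$ and length $a$ times that of $I$ (inclusion of endpoints is immaterial here). Cantor set $C(\alpha)$: let $C^0:=[0,1]$, viewed as the union of one interval. If $C^n$ is defined as the union of $2^n$ disjoint intervals $(I^n_\ell)_{\ell=1}^{2^n}$ of the same length $\delta_n$, set $C^{n+1}:=\bigcup_{\ell=1}^{2^n} I^n_\ell\setminus(\alpha_n * I^n_\ell)$, i.e. the middle proportion $\alpha_n$ of each interval is deleted; $C^{n+1}$ is a union of $2^{n+1}$ intervals. Then $C(\alpha):=\bigcap_{n\in\mathbb{N}}C^n$. Uniform measure $\mu_\alpha$: with $\mathcal{L}$ the Lebesgue measure, let $\mu^n$ be the normalized restriction of $\mathcal{L}$ to $C^n$, i.e. $\mu^n(B)=\mathcal{L}(B\cap C^n)/\mathcal{L}(C^n)$; $\mu_\alpha$ is the limit of $(\mu^n)_n$ in Wasserstein distance. Equivalently, $\mu_\alpha(I^n_\ell)=2^{-n}$ for all $n\in\mathbb{N}$ and $\ell\in\{1,\dots,2^n\}$. For $h>0$, $\mu_{\alpha,h}:=\frac12\left[(\mathrm{id}-h)_\#\mu_\alpha+(\mathrm{id}+h)_\#\mu_\alpha\right]$,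 where $f_\#$ denotes pushforward. $W_p(\mu,\nu):=\left(\inf_\eta\int|x-y|^pd\eta\right)^{1/p}$, the infimum being over Borel probability measures $\eta$ on $\mathbb{R}^2$ with marginals $\mu,\nu$. *)

(* Defs.v *)
From HB Require Import structures.
From mathcomp Require Import all_boot all_order all_algebra.
From mathcomp Require Import all_classical all_reals all_analysis.
From mathcomp Require Import lra.

Set Implicit Arguments.
Unset Strict Implicit.
Unset Printing Implicit Defensive.

Import Order.TTheory GRing.Theory Num.Theory.
Import numFieldNormedType.Exports.

Local Open Scope classical_set_scope.
Local Open Scope ring_scope.

(* A bounded interval is represented by the pair of its endpoints; the
   intervals that are kept are closed and the ones that are deleted are open. *)
Section cantor.
Context {R : realType}.
Implicit Types (a : R) (J : R * R) (alpha : R^nat) (n : nat).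

Definition midpoint J : R := (J.1 + J.2) / 2.

(* the interval a * J *)
Definition shrink a J : R * R :=
  (midpoint J - a * (J.2 - J.1) / 2, midpoint J + a * (J.2 - J.1) / 2).

Definition remove_middle a J : seq (R * R) :=
  [:: (J.1, (shrink a J).1); ((shrink a J).2, J.2)].

Fixpoint cantor_intervals alpha n : seq (R * R) :=
  if n is m.+1 then
    flatten [seq remove_middle (alpha m) J | J <- cantor_intervals alpha m]
  else [:: (0, 1)].

Definition cantor_level alpha n : set R :=
  \bigcup_(J in [set` cantor_intervals alpha n]) `[J.1, J.2]%classic.

Definition cantor_set alpha : set R := \bigcap_n cantor_level alpha n.

Lemma measurable_cantor_level alpha n :
  measurable (cantor_level alpha n : set (measurableTypeR R)).
Proof.
apply: fin_bigcup_measurable => [|J _]; first exact: finite_seq.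
exact: measurable_itv.
Qed.

Lemma size_cantor_intervals alpha n :
  size (cantor_intervals alpha n) = (2 ^ n)%N.
Proof.
elim: n => //= n IH.
suff -> (s : seq (R * R)) :
  size (flatten [seq remove_middle (alpha n) J | J <- s]) = (2 * size s)%N.
  by rewrite IH expnS.
by elim: s => //= J s ->; rewrite mulnS.
Qed.

Lemma remove_middleE a J : 0 <= a <= 1 -> J.1 <= J.2 ->
  `[J.1, J.2]%classic `\` `](shrink a J).1, (shrink a J).2[%classic =
  \bigcup_(K in [set` remove_middle a J]) `[K.1, K.2]%classic.
Proof.
case: J => l r /andP[a0 a1] /= lr.
have aw0 : 0 <= a * (r - l) by rewrite mulr_ge0// subr_ge0.
have aw1 : a * (r - l) <= r - l by rewrite ler_piMl// subr_ge0.
rewrite /remove_middle /shrink /midpoint /=.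
apply/seteqP; split=> x /=.
- rewrite !in_itv/= => -[/andP[lx xr]] /negP; rewrite negb_and -!leNgt.
  case/orP => h.
  + by eexists; [exact: mem_head | rewrite /= in_itv/= lx h].
  + by eexists; [rewrite /= !inE; apply/orP; right; apply: eqxx
                |rewrite /= in_itv/= h xr].
- case=> K /= Kin; rewrite !in_itv/= => /andP[h1 h2].
  move: Kin h1 h2; rewrite !inE => /orP[]/eqP->/= h1 h2.
  + split; first by apply/andP; split=> //; lra.
    by apply/negP; rewrite negb_and -!leNgt h2.
  + split; first by apply/andP; split=> //; lra.
    by apply/negP; rewrite negb_and -!leNgt h1 orbT.
Qed.

Lemma cantor_intervals_le alpha n (J : R * R) :
  (forall k, 0 < alpha k < 1) -> J \in cantor_intervals alpha n -> J.1 <= J.2.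
Proof.
move=> alpha01; elim: n J => [J|n IH J] /=.
  by rewrite inE => /eqP->/=.
move=> /flatten_mapP[K /IH lr].
case: K lr => l r /= lr.
have /andP[/ltW a0 /ltW a1] := alpha01 n.
have aw1 : alpha n * (r - l) <= r - l by rewrite ler_piMl// subr_ge0.
by rewrite /remove_middle /shrink /midpoint !inE => /orP[]/eqP->/=; lra.
Qed.

Lemma cantor_levelS alpha n : (forall k, 0 < alpha k < 1) ->
  cantor_level alpha n.+1 = \bigcup_(J in [set` cantor_intervals alpha n])
    (`[J.1, J.2]%classic `\`
     `](shrink (alpha n) J).1, (shrink (alpha n) J).2[%classic).
Proof.
move=> alpha01; have /andP[/ltW a0 /ltW a1] := alpha01 n.
have E (J : R * R) := @remove_middleE (alpha n) J (introT andP (conj a0 a1)).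
apply/seteqP; split=> x.
- case=> K /flatten_mapP[J Js KJ] xK; exists J; first exact: Js.
  by rewrite (E _ (cantor_intervals_le alpha01 Js)); exists K.
- case=> J Js; rewrite (E _ (cantor_intervals_le alpha01 Js)) => -[K KJ xK].
  by exists K => //; apply/flatten_mapP; exists J.
Qed.

(* Normalized restriction of the Lebesgue measure to cantor_level alpha n. The
   Dirac measure is only the default value mnormalize takes on measures of mass
   0 or +oo, which does not occur when alpha takes its values in ]0, 1[. *)
Definition cantor_prob alpha n : probability (measurableTypeR R) R :=
  mnormalize
    (mrestr (@lebesgue_measure R) (measurable_cantor_level alpha n))
    (\d_(0 : measurableTypeR R)).

End cantor.

Section wasserstein.
Context {R : realType}.
Local Notation T := (measurableTypeR R).
Local Open Scope ereal_scope.
Implicit Types mu nu : probability T R.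

Definition coupling mu nu : set (probability (T * T)%type R) :=
  [set eta | (forall A : set T, measurable A -> eta (fst @^-1` A) = mu A) /\
             (forall A : set T, measurable A -> eta (snd @^-1` A) = nu A)].

Definition wasserstein (p : R) mu nu : \bar R :=
  (ereal_inf [set \int[eta]_z ((`|(z.1 : R) - (z.2 : R)| `^ p)%R)%:E
             | eta in coupling mu nu]) `^ p^-1.

End wasserstein.

(* mu is the uniform measure on cantor_set alpha. All the measures involved
   live on [0, 1], on which the distances of all orders p >= 1 induce the same
   convergence; order 1 is the weakest requirement. *)
Definition cantor_uniform {R : realType} (alpha : R^nat)
    (mu : probability (measurableTypeR R) R) : Prop :=
  wasserstein 1 (cantor_prob alpha n) mu @[n --> \oo] --> 0%E.

Section split.
Context {R : realType}.
Local Notation T := (measurableTypeR R).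

Definition translate (h : R) : T -> T := fun x : R => x + h.

Let measurable_translate h : measurable_fun setT (translate h).
Proof. exact: measurable_realfun.measurable_funD. Qed.

HB.instance Definition _ h :=
  isMeasurableFun.Build _ _ T T (translate h) (measurable_translate h).

Variables (mu : probability T R) (h : R).

Definition split_measure : set T -> \bar R :=
  mscale (2^-1)%:nng (measure_add (distribution mu (translate (- h)))
                                  (distribution mu (translate h))).

HB.instance Definition _ := Measure.on split_measure.

Let split_measure1 : split_measure setT = 1%E.
Proof.
have E : measure_add (distribution mu (translate (- h)))
    (distribution mu (translate h)) setT = (1 + 1)%E.
  rewrite measure_addE.
  by congr (_ + _)%E; exact: (@probability_setT _ _ _ (distribution mu _)).
rewrite /split_measure /mscale.
by apply: etrans (congr1 _ E) _; rewrite -EFinD -EFinM/= mulVf.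
Qed.

HB.instance Definition _ :=
  Measure_isProbability.Build _ _ _ split_measure split_measure1.

End split.

(* Main.v *)
From HB Require Import structures.
Require Import Defs.
From mathcomp Require Import all_boot all_order all_algebra.
From mathcomp Require Import all_classical all_reals all_analysis.
From mathcomp Require Import measurable_realfun ring lra zify.

Import Order.TTheory GRing.Theory Num.Theory.
Import numFieldNormedType.Exports.

Local Open Scope classical_set_scope.
Local Open Scope ring_scope.

Set Implicit Arguments.
Unset Strict Implicit.
Unset Printing Implicit Defensive.

(** Why the distance is o(h). Let delta_n be the common length of the 2^n
    intervals of level n. At a scale h slightly below delta_n the measure mu,
    seen inside one interval of level n, is nearly Lebesgue measure: deeper
    levels remove only proportions alpha_m <= alpha_n, and the displacement
    that they cause sums up to at most alpha_n delta_n (left_end_approx). For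
    Lebesgue measure on an interval, a translation by h agrees with the measure
    itself except near the two ends, so mu and its split version are nearly
    equal up to a boundary layer of mass of order h / delta_n, where points
    have to be displaced by h.

    To turn this into a coupling, cut each interval of level n into its
    2^r descendants of level n + r, which are so small that all points of one
    descendant may be identified. Each has mass 2^-(n+r) (cantor_uniform_cell),
    so any permutation of the pairs (descendant, sign) yields a coupling of mu
    with its split version (wasserstein_split_le): the law on the source
    descendant is paired with the law on the target one, shifted by h with the
    sign of the target. The permutation used here (slide) moves the index by
    m ~ h 2^r / delta_n in the direction opposite to the sign of the target,
    which cancels the shift by h, and leaves the pair unchanged when the move
    would exit the interval of level n; it is an involution. A fraction m / 2^r
    of the pairs is left unchanged, and there the cost is about h. With
    D = 3 alpha_n delta_n this gives
      W_p^p <= D^p + (h / delta_n) (h + D)^p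
    (wasserstein_split_estimate).

    It remains to choose n from h. For a large constant K one can take n with
    K h <= delta_n <= A h, where A depends on K and alpha_0 only (width_scale).
    Then h / delta_n <= 1 / K and D / h <= 3 A alpha_n, which tends to 0 as
    h -> 0, because n -> oo.

    The masses of the descendants are read off from the convergence of the
    normalized Lebesgue measures in W_1: these give mass at least 2^-N to every
    interval of level N once their own level exceeds N, and Markov's inequality
    for nearly optimal couplings transfers the bound to mu, on a slight
    enlargement of the interval (wasserstein_cvg_le). The enlargements are still
    disjoint, so that the lower bounds are equalities. *)

(** * Markov's inequality for couplings *)

Section markov.
Context {R : realType}.
Local Notation T := (measurableTypeR R).
Local Open Scope ereal_scope.

Lemma measurable_cost (p : R) :
  measurable_fun setT
    ((fun z => ((`|(z.1 : R) - (z.2 : R)| `^ p)%R)%:E) : T * T -> \bar R).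
Proof.
apply/measurable_EFinP.
apply: (measurableT_comp (@measurable_powR R p)).
apply: measurableT_comp => //.
by apply: measurable_funB.
Qed.

(** Mass of A that a coupling does not send into B travels a distance at least
    e, so that Markov's inequality bounds it by the cost. *)
Lemma coupling_markov (la mu : probability T R) eta (A B : set T) (e : R) :
  measurable A -> measurable B -> (0 < e)%R ->
  (forall x y : R, A x -> (`|x - y| < e)%R -> B y) ->
  coupling la mu eta ->
  la A <= mu B +
    (e^-1)%:E * \int[eta]_z ((`|(z.1 : R) - (z.2 : R)| `^ 1)%R)%:E.
Proof.
move=> mA mB e0 AB [eta1 eta2].
pose g (z : T * T) : \bar R := ((z.1 : R) - (z.2 : R))%:E.
have mg : measurable_fun setT g.
  by apply/measurable_EFinP; apply: measurable_funB.
set C := [set x | e%:E <= `|g x|].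
have mC : measurable C.
  rewrite -[C]setTI.
  by apply: emeasurable_fun_c_infty => //; exact: measurableT_comp.
have hM := @le_integral_abse _ _ _ eta setT measurableT g e mg e0.
rewrite setTI -/C in hM.
rewrite -(eta1 A mA) -(eta2 B mB).
have mA' : measurable (fst @^-1` A : set (T * T)).
  by rewrite -[_ @^-1` _]setTI; exact: measurable_fst.
have mB' : measurable (snd @^-1` B : set (T * T)).
  by rewrite -[_ @^-1` _]setTI; exact: measurable_snd.
apply: (@le_trans _ _ (eta ((snd @^-1` B) `|` C))).
  apply: le_measure; rewrite ?inE//; first exact: measurableU.
  move=> [x y] /= Ax; have [h|h] := ltP `|x - y|%R e.
    by left; apply: AB Ax h.
  by right; rewrite /C/= /g/= lee_fin.
apply: (le_trans (measureU2 _ mB' mC)).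
apply: leeD => //.
rewrite muleC lee_pdivlMr// muleC.
apply: le_trans hM _.
rewrite le_eqVlt; apply/orP; left; apply/eqP; apply: eq_integral => z _.
by rewrite /g/= powRr1.
Qed.

(** A weak form of the portmanteau theorem, for an enlargement B of A: it spares
    the discussion of the mass that the limit puts on the boundary of A. *)
Lemma wasserstein_cvg_le (la : nat -> probability T R) (mu : probability T R)
    (A B : set T) (e c : R) (N : nat) :
  measurable A -> measurable B -> (0 < e)%R ->
  (forall x y : R, A x -> (`|x - y| < e)%R -> B y) ->
  wasserstein 1 (la n) mu @[n --> \oo] --> 0 ->
  (forall n, (N <= n)%N -> c%:E <= la n A) ->
  c%:E <= mu B.
Proof.
move=> mA mB e0 AB W0 cA.
(* a coupling of cost below r * e loses mass at most r by Markov's inequality *)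
apply/lee_addgt0Pr => r r0.
have re0 : (0 < r * e)%R by rewrite mulr_gt0.
have : \forall n \near \oo, wasserstein 1 (la n) mu < (r * e)%:E.
  move/fine_cvgP: W0 => [W0 /cvgrPdist_lt /(_ _ re0) W1].
  near=> n; rewrite -[X in X < _]fineK; last by near: n.
  rewrite lte_fin; apply: le_lt_trans (ler_norm _) _.
  by rewrite -normrN -[(- _)%R]add0r; near: n.
move=> [M _ hM].
have := hM (maxn M N) (leq_maxl _ _).
rewrite /= /wasserstein invr1 poweRe1; last first.
  apply: le_ereal_inf_tmp => _ [eta _ <-].
  by apply: integral_ge0 => z _; rewrite lee_fin powR_ge0.
move=> /ereal_inf_lt[_ [eta heta <-]] heta2.
apply: le_trans (cA _ (leq_maxr M N)) _.
apply: le_trans (coupling_markov mA mB e0 AB heta) _.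
apply: leeD => //.
by rewrite muleC lee_pdivrMr// ltW.
Unshelve. all: end_near. Qed.

End markov.

(** * Couplings of uniform mixtures *)

Section mixture.
Context d1 d2 (T1 : measurableType d1) (T2 : measurableType d2) (R : realType).
Local Open Scope ereal_scope.

Let productE (m : probability T1 R) (n : probability T2 R) A B :
  measurable A -> measurable B -> (m \x n) (A `*` B) = m A * n B.
Proof. exact: product_measure1E. Qed.

Lemma product_integral_le (m : probability T1 R) (n : probability T2 R)
    (A : set T1) (B : set T2) (f : T1 * T2 -> \bar R) (c : R) :
  measurable A -> measurable B -> m A = 1 -> n B = 1 ->
  measurable_fun setT f -> (forall z, 0 <= f z) ->
  (forall x y, A x -> B y -> f (x, y) <= c%:E) ->
  \int[m \x n]_z f z <= c%:E.
Proof.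
move=> mA mB mA1 nB1 mf f0 AB.
have mAB : measurable (A `*` B) by exact: measurableX.
have mn1 : (m \x n) (A `*` B) = 1.
  by rewrite productE// mA1 nB1 mule1.
have mnT : (m \x n) setT = 1.
  by rewrite -setXTT productE// !probability_setT mule1.
have mn0 : (m \x n) (~` (A `*` B)) = 0.
  by rewrite -setTD measureD//= ?setTI mnT ?mn1 ?subee// ltry.
rewrite (@ge0_negligible_integral _ _ _ (m \x n) setT (~` (A `*` B)))//.
  rewrite setDE setCK setTI.
  rewrite (le_trans (y := \int[m \x n]_(z in A `*` B) cst c%:E z))//.
    apply: ge0_le_integral => //.
    + exact: measurable_funTS mf.
    + by move=> [x y] [/= Ax By]; exact: AB.
  by rewrite integral_cst// [X in _ * X]mn1 mule1.
exact: measurableC.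
Qed.

Variables (Z : finType) (z0 : Z).
Variables (muz : Z -> probability T1 R) (nuz : Z -> probability T2 R).

Definition mixture_weight : {nonneg R}%R := ((#|Z|%:R^-1)%:nng)%R.

(** Finite sums of measures are indexed by an initial segment of nat, hence the
    enumeration of Z. *)
Definition mixture_summand (k : nat) : {measure set (T1 * T2) -> \bar R} :=
  let z := nth z0 (enum Z) k in mscale mixture_weight (muz z \x nuz z).

Definition mixture_coupling : set (T1 * T2) -> \bar R :=
  msum mixture_summand #|Z|.

HB.instance Definition _ := Measure.on mixture_coupling.

Let big_enum_nth (F : Z -> \bar R) :
  \sum_(k < #|Z|) F (nth z0 (enum Z) k) = \sum_z F z.
Proof.
rewrite cardE -(big_mkord xpredT (fun k => F (nth z0 (enum Z) k))).
by rewrite -(big_nth z0 xpredT F) big_enum.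
Qed.

Let mixture_couplingE A : mixture_coupling A =
  \sum_z ((#|Z|%:R^-1)%R)%:E * (muz z \x nuz z) A.
Proof. by rewrite -big_enum_nth. Qed.

Let mixture_couplingT : mixture_coupling setT = 1.
Proof.
have Z0 : (0 < #|Z|%:R :> R)%R by rewrite ltr0n; apply/card_gt0P; exists z0.
rewrite mixture_couplingE (eq_bigr (fun=> ((#|Z|%:R^-1)%R)%:E)); last first.
  move=> z _; rewrite -setXTT productE//.
  by rewrite !probability_setT !mule1.
by rewrite sumEFin sumr_const -(mulr_natl _ #|_|) divff// lt0r_neq0.
Qed.

HB.instance Definition _ :=
  Measure_isProbability.Build _ _ _ mixture_coupling mixture_couplingT.

Lemma mixture_coupling_fst A : measurable A ->
  mixture_coupling (fst @^-1` A) = \sum_z ((#|Z|%:R^-1)%R)%:E * muz z A.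
Proof.
move=> mA; rewrite mixture_couplingE; apply: eq_bigr => z _; congr (_ * _).
rewrite (_ : fst @^-1` A = A `*` setT).
  by rewrite productE// probability_setT mule1.
by apply/seteqP; split=> [[x y]|[x y] []].
Qed.

Lemma mixture_coupling_snd A : measurable A ->
  mixture_coupling (snd @^-1` A) = \sum_z ((#|Z|%:R^-1)%R)%:E * nuz z A.
Proof.
move=> mA; rewrite mixture_couplingE; apply: eq_bigr => z _; congr (_ * _).
rewrite (_ : snd @^-1` A = setT `*` A).
  by rewrite productE// probability_setT mul1e.
by apply/seteqP; split=> [[x y]|[x y] []].
Qed.

Lemma mixture_coupling_integral_le (A : Z -> set T1) (B : Z -> set T2)
    (f : T1 * T2 -> \bar R) (c : Z -> R) :
  (forall z, measurable (A z)) -> (forall z, measurable (B z)) ->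
  (forall z, muz z (A z) = 1) -> (forall z, nuz z (B z) = 1) ->
  measurable_fun setT f -> (forall z, 0 <= f z) ->
  (forall z x y, A z x -> B z y -> f (x, y) <= (c z)%:E) ->
  \int[mixture_coupling]_z f z <= ((\sum_z c z) / #|Z|%:R)%R%:E.
Proof.
move=> mA mB muA nuB mf f0 AB.
rewrite [leLHS](@ge0_integral_measure_sum _ _ _ mixture_summand)//.
pose F z := \int[mscale mixture_weight (muz z \x nuz z)]_x f x.
rewrite [leLHS](big_enum_nth F).
rewrite mulr_suml -sumEFin; apply: lee_sum => z _.
rewrite /F ge0_integral_mscale//= mulrC EFinM.
apply: lee_wpmul2l; first by rewrite lee_fin.
exact: (product_integral_le (mA z) (mB z)) (AB z).
Qed.

End mixture.

Section wasserstein_mixture.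
Context {R : realType}.
Local Notation T := (measurableTypeR R).
Local Open Scope ereal_scope.

(** Two uniform mixtures with the same index set can be coupled piece by piece,
    with independent points inside each pair of pieces; the cost is controlled
    as soon as the pieces are small. *)
Lemma wasserstein_mixture_le (Z : finType) (z0 : Z)
    (mu nu : probability T R) (muz nuz : Z -> probability T R)
    (A B : Z -> set T) (D : Z -> R) (p : R) :
  (forall X, measurable X -> mu X = \sum_z ((#|Z|%:R^-1)%R)%:E * muz z X) ->
  (forall X, measurable X -> nu X = \sum_z ((#|Z|%:R^-1)%R)%:E * nuz z X) ->
  (0 < p)%R -> (forall z, 0 <= D z)%R ->
  (forall z, measurable (A z)) -> (forall z, measurable (B z)) ->
  (forall z, muz z (A z) = 1) -> (forall z, nuz z (B z) = 1) ->
  (forall z (x y : R), A z x -> B z y -> (`|x - y| <= D z)%R) ->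
  wasserstein p mu nu <= (((\sum_z D z `^ p) / #|Z|%:R) `^ p^-1)%R%:E.
Proof.
move=> muE nuE p0 D0 mA mB muA nuB AB.
rewrite -poweR_EFin; apply: gt0_ler_poweR; first by rewrite invr_ge0 ltW.
- rewrite in_itv/= leey andbT; apply: le_ereal_inf_tmp => _ [eta _ <-].
  by apply: integral_ge0 => z _; rewrite lee_fin powR_ge0.
- rewrite in_itv/= leey andbT lee_fin divr_ge0//.
  by apply: sumr_ge0 => z _; rewrite powR_ge0.
pose eta := mixture_coupling z0 muz nuz.
apply: ge_ereal_inf.
exists (\int[eta]_z ((`|(z.1 : R) - (z.2 : R)| `^ p)%R)%:E).
  exists eta => //; split=> X mX.
  - by rewrite muE// [LHS]mixture_coupling_fst.
  - by rewrite nuE// [LHS]mixture_coupling_snd.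
apply: (@mixture_coupling_integral_le _ _ _ _ _ _ _ _ _ A B _
  (fun z => D z `^ p)%R) => //.
- exact: measurable_cost.
- move=> z x y Ax By /=; rewrite lee_fin.
  by apply: ge0_ler_powR; rewrite ?nnegrE//; [exact: ltW|exact: AB].
Qed.

End wasserstein_mixture.

(** * Splitting a measure with equally weighted cells *)

Section cells.
Context d (T : measurableType d) (R : realType).
Local Open Scope ereal_scope.

Lemma mnormalizeE (nu : {measure set T -> \bar R}) P (c : R) X :
  (0 < c)%R -> nu setT = c%:E -> mnormalize nu P X = nu X * (c^-1)%:E.
Proof. by move=> c0 E; rewrite /mnormalize E /= orbF eqe gt_eqF. Qed.

Variables (I : finType).

Lemma measure_bigcup_fintype (mu : {measure set T -> \bar R}) (F : I -> set T) :
  (forall i, measurable (F i)) -> trivIset setT F ->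
  mu (\bigcup_i F i) = \sum_i mu (F i).
Proof.
move=> mF tF; rewrite measure_fin_bigcup//; last exact: finite_finset.
rewrite (_ : setT = [set` index_enum I]).
  by rewrite -fsbig_seq// index_enum_uniq.
by apply/seteqP; split=> i //= _; rewrite mem_index_enum.
Qed.

Variables (mu : probability T R) (J : I -> set T).
Hypothesis mJ : forall i, measurable (J i).
Hypothesis tJ : trivIset setT J.
Hypothesis muJ : forall i, mu (J i) = ((#|I|%:R^-1)%R)%:E.

(** The conditional law of mu given J i. *)
Definition cell_law (i : I) : probability T R :=
  mnormalize (mrestr mu (mJ i)) (\d_point).

Let cardI_gt0 (i : I) : (0 < #|I|%:R :> R)%R.
Proof. by rewrite ltr0n; apply/card_gt0P; exists i. Qed.

Lemma cell_lawE i X : cell_law i X = mu (X `&` J i) * (#|I|%:R)%:E.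
Proof.
apply: etrans (mnormalizeE (c := #|I|%:R^-1) _ _ _ _) _.
- by rewrite invr_gt0 cardI_gt0.
- by rewrite /= /mrestr setTI muJ.
- by rewrite invrK.
Qed.

Lemma cell_law_cell i : cell_law i (J i) = 1.
Proof.
by rewrite cell_lawE setIid muJ -EFinM mulVf// gt_eqF// cardI_gt0.
Qed.

(** The cells carry the whole mass of mu, so that mu is the uniform mixture of
    its conditional laws. *)
Lemma measure_cells (i0 : I) X : measurable X ->
  mu X = \sum_i ((#|I|%:R^-1)%R)%:E * cell_law i X.
Proof.
move=> mX; set U := \bigcup_i J i.
have mU : measurable U.
  by apply: fin_bigcup_measurable => //; exact: finite_finset.
have U1 : mu U = 1.
  rewrite measure_bigcup_fintype//.
  rewrite (eq_bigr (fun=> ((#|I|%:R^-1)%R)%:E)) => [|i _]; last exact: muJ.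
  rewrite sumEFin sumr_const -(mulr_natl _ #|_|) divff// gt_eqF//.
  exact: cardI_gt0.
have UC : mu (X `\` U) = 0.
  apply/eqP; rewrite -measure_le0.
  apply: (@le_trans _ _ (mu (~` U))); last first.
    by rewrite probability_setC// U1 subee.
  by apply: le_measure; rewrite ?inE//; [exact: measurableD|exact: measurableC].
transitivity (mu (X `&` U)).
  by rewrite (measureDI mu mX mU) [X in X + _]UC add0e.
rewrite setI_bigcupr.
rewrite measure_bigcup_fintype//.
- apply: eq_bigr => i _; rewrite cell_lawE muleCA -EFinM mulVf ?mule1//.
  by rewrite gt_eqF// cardI_gt0.
- by move=> i; exact: measurableI.
- exact: trivIset_setIl.
Qed.

End cells.

Section split_cells.
Context {R : realType}.
Local Notation T := (measurableTypeR R).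
Local Open Scope ereal_scope.
Variables (I : finType) (mu : probability T R) (J : I -> set T).
Hypothesis mJ : forall i, measurable (J i).
Hypothesis tJ : trivIset setT J.
Hypothesis muJ : forall i, mu (J i) = ((#|I|%:R^-1)%R)%:E.

Definition signed_shift (h : R) (b : bool) : R := if b then h else (- h)%R.

Lemma split_measureE (h : R) (X : set T) : split_measure mu h X =
  (2^-1)%R%:E * (mu (translate (- h) @^-1` X) + mu (translate h @^-1` X)).
Proof.
rewrite /split_measure /mscale /=; congr (_ * _).
by rewrite [LHS]measure_addE.
Qed.

Let sum_signed (G : I * bool -> \bar R) : (forall z, 0 <= G z) ->
  \sum_z ((#|I| * 2)%:R^-1)%R%:E * G z =
  (2^-1)%R%:E * (\sum_i (#|I|%:R^-1)%R%:E * G (i, false) +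
                \sum_i (#|I|%:R^-1)%R%:E * G (i, true)).
Proof.
move=> G0.
transitivity (\sum_i \sum_b ((#|I| * 2)%:R^-1)%R%:E * G (i, b)).
  by rewrite pair_bigA; apply: eq_bigr => -[].
rewrite -big_split/= ge0_sume_distrr; last first.
  by move=> i _; apply: adde_ge0; rewrite mule_ge0// lee_fin.
apply: eq_bigr => i _; rewrite big_bool/= natrM invfM EFinM addeC.
by rewrite ge0_muleDr ?mule_ge0 ?lee_fin// !muleA (muleC (2^-1)%:E).
Qed.

(** Both mu and its split version are uniform mixtures over the pairs (i, b),
    the latter with the law of the cell i shifted according to the sign b. Any
    permutation F of the pairs therefore matches the pieces. *)
Lemma wasserstein_split_le (i0 : I) (h p : R) (F : I * bool -> I * bool)
    (D : I * bool -> R) :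
  injective F -> (0 < p)%R -> (forall z, 0 <= D z)%R ->
  (forall z (x y : R), J z.1 x -> J (F z).1 y ->
    (`|x - (y + signed_shift h (F z).2)| <= D z)%R) ->
  wasserstein p mu (split_measure mu h) <=
    (((\sum_z D z `^ p) / (#|I| * 2)%:R) `^ p^-1)%R%:E.
Proof.
move=> injF p0 D0 AB.
have cardE : #|{: I * bool}| = (#|I| * 2)%N by rewrite card_prod card_bool.
rewrite -cardE.
pose law (z : I * bool) := cell_law mu mJ z.1.
pose slaw z : probability T R :=
  distribution (cell_law mu mJ (F z).1) (translate (signed_shift h (F z).2)).
pose B z : set T := translate (- signed_shift h (F z).2) @^-1` J (F z).1.
have lawJ i : law (i, true) (J i) = 1 := cell_law_cell mJ muJ i.
apply: (@wasserstein_mixture_le R _ (i0, true) mu (split_measure mu h) law slaw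
  (fun z => J z.1) B D p _ _ p0 D0).
- move=> X mX; rewrite cardE sum_signed//.
  rewrite -(measure_cells mJ tJ muJ i0 mX) -[in RHS](mule1 (mu X)).
  rewrite -muleDr ?fin_num_measure//.
  by rewrite muleCA -EFinD -EFinM mulVf ?mule1// pnatr_eq0.
- move=> X mX.
  apply: etrans (split_measureE h X) _; rewrite cardE.
  pose G (z : I * bool) :=
    cell_law mu mJ z.1 (translate (signed_shift h z.2) @^-1` X).
  transitivity (\sum_z ((#|I| * 2)%:R^-1)%R%:E * G z); last first.
    by rewrite (reindex_inj injF).
  rewrite sum_signed; last by move=> z; exact: measure_ge0.
  have mtr c : measurable (translate c @^-1` X).
    rewrite -[_ @^-1` _]setTI.
    exact: (@measurable_funPT _ _ _ _ (translate c)).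
  by rewrite /G/= -!(measure_cells mJ tJ muJ i0 (mtr _)).
- by [].
- move=> z; rewrite -[B z]setTI.
  exact: (@measurable_funPT _ _ _ _ (translate _)).
- move=> z; exact: lawJ.
- move=> z; rewrite /slaw /distribution /pushforward /=.
  rewrite [X in cell_law _ _ _ X](_ : _ = J (F z).1).
    exact: cell_law_cell.
  by apply/seteqP; split=> x /=; rewrite /B/= /translate/= addrK.
- move=> z x y Jx Jy.
  by have := AB z x _ Jx Jy; rewrite /translate/= subrK.
Qed.

End split_cells.

(** * Geometry of the Cantor intervals *)

Section levels.
Context {R : realType}.
Variable alpha : R^nat.
Hypothesis alpha01 : forall n, 0 < alpha n < 1.

Fixpoint width (n : nat) : R :=
  if n is m.+1 then (1 - alpha m) / 2 * width m else 1.

(** Left endpoint of the k-th interval of level n, counted from the left: the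
    parity of k tells whether the interval is the left or the right child of
    its parent, which has index k./2. *)
Fixpoint left_end (n k : nat) : R :=
  if n is m.+1 then
    left_end m k./2 + (if odd k then (1 + alpha m) / 2 * width m else 0)
  else 0.

Lemma width_gt0 n : 0 < width n.
Proof.
elim: n => //= n IH; rewrite mulr_gt0// divr_gt0// subr_gt0.
by case/andP: (alpha01 n).
Qed.

Lemma width_addn n r : width (n + r) <= width n / 2 ^+ r.
Proof.
elim: r => [|r IH]; first by rewrite addn0 expr0 divr1.
rewrite addnS /= exprS invfM [_^-1 * _]mulrC mulrA [leRHS]mulrC.
apply: ler_pM => //.
- by rewrite divr_ge0// subr_ge0; case/andP: (alpha01 (n + r)) => _ /ltW.
- exact/ltW/width_gt0.
- by case/andP: (alpha01 (n + r)) => a0 _; lra.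
Qed.

Lemma cantor_intervalsE n : cantor_intervals alpha n =
  [seq (left_end n k, left_end n k + width n) | k <- iota 0 (2 ^ n)].
Proof.
elim: n => /= [|n ->]; first by rewrite add0r.
set f := fun k => _; rewrite -map_comp.
have -> : iota 0 (2 ^ n.+1) =
    flatten [seq [:: k.*2; k.*2.+1] | k <- iota 0 (2 ^ n)].
  rewrite expnS mul2n.
  suff E m k : iota k.*2 m.*2 =
      flatten [seq [:: k.*2; k.*2.+1] | k <- iota k m] by exact: (E _ 0%N).
  by elim: m k => //= m IH k; rewrite -doubleS IH.
elim: (iota 0 (2 ^ n)) => //= k s ->.
rewrite /f /= uphalf_double doubleK odd_double addr0 /remove_middle /=.
by rewrite /shrink /midpoint /=; congr [:: (_, _), (_, _) & _]; field.
Qed.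

(** The interval k of level n + r descends from, and lies inside, the interval
    k %/ 2 ^ r of level n. *)
Lemma left_end_nested n r k :
  left_end n (k %/ 2 ^ r) <= left_end (n + r) k /\
  left_end (n + r) k + width (n + r) <= left_end n (k %/ 2 ^ r) + width n.
Proof.
elim: r k => [|r IH] k; first by rewrite expn0 divn1 addn0.
rewrite addnS /= expnS divnMA divn2.
have [l1 l2] := IH k./2.
have := width_gt0 (n + r); have := alpha01 (n + r).
move: (width (n + r)) l2 => d l2 /andP[a0 a1] d0; set a := alpha _ in a0 a1 *.
have : 0 <= a * d by rewrite mulr_ge0// ltW.
have : 0 <= (1 - a) * d by apply: mulr_ge0; lra.
by move=> *; case: ifP => _; split; lra.
Qed.

(** Consecutive intervals of one level are separated by a gap of positive
    length, which leaves room to fatten them without making them meet. *)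
Lemma left_end_gap n : exists2 g, 0 < g &
  forall k l, (k < l < 2 ^ n)%N -> left_end n k + width n + g <= left_end n l.
Proof.
elim: n => [|n [g g0 IH]].
  exists 1 => // k l; rewrite expn0 ltnS leqn0.
  by case: l => [|l]; rewrite ?andbF ?ltn0.
have := alpha01 n; have := width_gt0 n => d0 /andP[a0 a1].
exists (Num.min g (alpha n * width n)).
  by rewrite lt_min g0 mulr_gt0.
move=> k l /andP[kl ln] /=.
have g1 : Num.min g (alpha n * width n) <= g by rewrite ge_min lexx.
have g2 : Num.min g (alpha n * width n) <= alpha n * width n.
  by rewrite ge_min lexx orbT.
have [e|kl2] := eqVneq k./2 l./2.
  have [-> ->] : odd k = false /\ odd l = true by lia.
  by rewrite e; lra.
have /IH : (k./2 < l./2 < 2 ^ n)%N by move: ln; rewrite expnS; lia.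
have : 0 <= alpha n * width n by rewrite mulr_ge0// ltW.
have : 0 <= (1 - alpha n) * width n by apply: mulr_ge0; lra.
by move=> *; case: ifP => _; case: ifP => _; lra.
Qed.

Hypothesis alpha_nincr : nonincreasing_seq alpha.

(** Inside an interval of level n, the left endpoints of level n + r are within
    alpha n * width n of a regular grid. The induction goes from the top:
    passing from level n to level n.+1 moves the interpolating grid by at most
    alpha n * width n / 2, while the error bound at level n.+1 is at most half
    of the one at level n since alpha is nonincreasing. *)
Lemma left_end_approx n r k :
  `|left_end (n + r) k -
    (left_end n (k %/ 2 ^ r) + (k %% 2 ^ r)%:R / 2 ^+ r * width n)| <=
  alpha n * width n.
Proof.
elim: r n => [|r IH] n.
  rewrite expn0 divn1 modn1 mul0r mul0r addr0 addn0 subrr normr0.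
  by rewrite mulr_ge0// ltW// ?width_gt0//; case/andP: (alpha01 n).
rewrite addnS -addSn.
have := IH n.+1; set q := (k %/ 2 ^ r)%N; set i := (k %% 2 ^ r)%N => {}IH.
have -> : (k %/ 2 ^ r.+1 = q./2)%N by rewrite expnSr divnMA divn2.
have -> : (k %% 2 ^ r.+1 = odd q * 2 ^ r + i)%N.
  rewrite {1}(divn_eq k (2 ^ r)) -/q -/i -{1}(odd_double_half q) mulnDl.
  rewrite addnAC addnC -mul2n -mulnA mulnCA -expnS modnMDl modn_small//.
  rewrite expnS mul2n -addnn; have : (i < 2 ^ r)%N by rewrite ltn_mod expn_gt0.
  by case: (odd q) => /=; lia.
set L := left_end (n.+1 + r) k in IH *.
have d0 := width_gt0 n; have /andP[a0 a1] := alpha01 n.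
have M0 : 0 < 2 ^+ r :> R by rewrite exprn_gt0.
(* the relative position inside the interval q of level n.+1 *)
set x : R := i%:R / 2 ^+ r.
have x0 : 0 <= x by rewrite divr_ge0// ltW.
have x1 : x <= 1.
  rewrite ler_pdivrMr// mul1r -natrX ler_nat ltnW//.
  by rewrite ltn_mod expn_gt0.
have -> : (odd q * 2 ^ r + i)%:R / 2 ^+ r.+1 = ((odd q)%:R + x) / 2 :> R.
  rewrite natrD natrM natrX exprS /x; field; exact: lt0r_neq0.
move: IH; rewrite /= -/x.
have a10 : alpha n.+1 <= alpha n by apply: alpha_nincr.
have -> : alpha n.+1 * ((1 - alpha n) / 2 * width n) =
   alpha n.+1 * (1 - alpha n) / 2 * width n by ring.
have : alpha n.+1 * (1 - alpha n) / 2 * width n <= alpha n / 2 * width n.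
  rewrite ler_pM2r// ler_pM2r ?invr_gt0//.
  have /andP[b0 _] := alpha01 n.+1; nra.
move: (alpha n.+1 * _) => c hc.
have xd1 : 0 <= x * (alpha n * width n) by rewrite !mulr_ge0// ltW.
have xd2 : 0 <= (1 - x) * (alpha n * width n).
  by apply: mulr_ge0; [lra|apply: mulr_ge0; lra].
rewrite !ler_norml => /andP[h1 h2]; case: (odd q) h1 h2 => /= h1 h2.
  by apply/andP; split; lra.
by apply/andP; split; lra.
Qed.

End levels.

(** * Mass of the Cantor intervals *)

Section uniform.
Context {R : realType}.
Local Notation T := (measurableTypeR R).
Variable alpha : R^nat.
Hypothesis alpha01 : forall n, 0 < alpha n < 1.
Local Notation L := (left_end alpha).
Local Notation width := (width alpha).

(** The margin e is what wasserstein_cvg_le asks for; e = 0 gives back the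
    interval itself. *)
Definition cell (n : nat) (e : R) (k : nat) : set T :=
  `[L n k - e, L n k + width n + e]%classic.

Lemma measurable_cell n e k : measurable (cell n e k).
Proof. exact: measurable_itv. Qed.

Lemma lebesgue_cell n k :
  (@lebesgue_measure R (cell n 0 k) = (width n)%:E)%E.
Proof.
rewrite /cell lebesgue_measure_itv/= lte_fin.
have := width_gt0 alpha01 n => l0.
by rewrite ifT -?EFinB; [congr EFin; ring | lra].
Qed.

Lemma cell_sub_level n k : (k < 2 ^ n)%N ->
  cell n 0 k `<=` cantor_level alpha n.
Proof.
move=> kn; rewrite /cell subr0 addr0 => x Ix.
exists (L n k, L n k + width n) => //=.
by rewrite cantor_intervalsE; apply/mapP; exists k => //; rewrite mem_iota.
Qed.

Lemma lebesgue_level n :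
  (@lebesgue_measure R (cantor_level alpha n) <= ((2 ^ n)%:R * width n)%:E)%E.
Proof.
apply: (@le_trans _ _ (\sum_(k < 2 ^ n) @lebesgue_measure R (cell n 0 k))%E).
  apply: (@content_subadditive _ _ _ (@lebesgue_measure R)).
  - by move=> k _; exact: measurable_cell.
  - exact: measurable_cantor_level.
  - move=> x [J /= Js xJ]; move: Js; rewrite cantor_intervalsE => /mapP[k].
    rewrite mem_iota/= add0n => kn EJ.
    rewrite -(bigcup_mkord (2 ^ n) (cell n 0)); exists k => //=.
    by move: xJ; rewrite EJ /cell subr0 addr0.
rewrite (eq_bigr (fun=> (width n)%:E)) => [|k _]; last exact: lebesgue_cell.
by rewrite sumEFin sumr_const card_ord -(mulr_natl (width n) (2 ^ n)).
Qed.

Lemma cantor_prob_cell n k : (k < 2 ^ n)%N ->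
  (((2 ^ n)%:R^-1)%:E <= cantor_prob alpha n (cell n 0 k))%E.
Proof.
move=> kn.
pose nu : {measure set T -> \bar R} :=
  mrestr (@lebesgue_measure R) (measurable_cantor_level alpha n).
have l0 := width_gt0 alpha01 n.
have P0 : 0 < (2 ^ n)%:R :> R by rewrite ltr0n expn_gt0.
have nuc : nu (cell n 0 k) = (width n)%:E.
  rewrite /nu /= /mrestr setIidl; first exact: lebesgue_cell.
  exact: cell_sub_level.
have nuT : (nu setT <= ((2 ^ n)%:R * width n)%:E)%E.
  by rewrite /nu /= /mrestr setTI; exact: lebesgue_level.
have nuT0 : ((width n)%:E <= nu setT)%E.
  by rewrite -nuc; apply: le_measure; rewrite ?inE//; exact: measurable_cell.
have nufin : nu setT \is a fin_num.
  rewrite ge0_fin_numE//; exact: le_lt_trans nuT (ltry _).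
rewrite -(fineK nufin) !lee_fin in nuT nuT0.
have c0 := lt_le_trans l0 nuT0.
have -> : cantor_prob alpha n (cell n 0 k) =
   (nu (cell n 0 k) * ((fine (nu setT))^-1)%:E)%E.
  by apply: mnormalizeE => //; rewrite fineK.
rewrite nuc -EFinM lee_fin ler_pdivlMr// mulrC ler_pdivrMr//.
by rewrite mulrC.
Qed.

Lemma trivIset_cell n : exists2 g, 0 < g & forall e, 0 <= e < g ->
  trivIset setT (fun k : 'I_(2 ^ n) => cell n e k).
Proof.
have [g g0 hg] := left_end_gap alpha01 n.
exists (g / 2); first by rewrite divr_gt0.
move=> e /andP[e0 eg]; apply/trivIsetP => i j _ _ ij.
wlog ltij : i j ij / (i < j)%N.
  move=> W; case: (ltngtP i j) => [|ji|/val_inj E].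
  - exact: W.
  - by rewrite setIC; apply: W => //; rewrite eq_sym.
  - by rewrite E eqxx in ij.
have hh : L n i + width n + g <= L n j by apply: hg; rewrite ltij ltn_ord.
rewrite -subset0 => x [] /=; rewrite /cell/= !in_itv/=.
by move=> /andP[_ h1] /andP[h2 _]; lra.
Qed.

(** The interval contains its 2 ^ r descendants of level N + r, which are disjoint
    and have mass at least 2 ^- (N + r) each. *)
Lemma cantor_prob_ancestor N r k : (k < 2 ^ N)%N ->
  (((2 ^ N)%:R^-1)%:E <= cantor_prob alpha (N + r) (cell N 0 k))%E.
Proof.
move=> kN; set n := (N + r)%N.
have ch (i : 'I_(2 ^ r)) : (k * 2 ^ r + i < 2 ^ n)%N.
  rewrite /n expnD; apply: (@leq_trans (k.+1 * 2 ^ r)).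
    by rewrite mulSn addnC ltn_add2r.
  by rewrite leq_mul2r kN orbT.
pose F (i : 'I_(2 ^ r)) : set T := cell n 0 (k * 2 ^ r + i).
have tF : trivIset setT F.
  have [g g0 hg] := trivIset_cell n.
  have /trivIsetP t0 := hg 0 (introT andP (conj (lexx _) g0)).
  apply/trivIsetP => i j _ _ ij.
  apply: (t0 (Ordinal (ch i)) (Ordinal (ch j)) I I).
  by apply: contra ij => /eqP[] /addnI /val_inj ->.
have sub : \bigcup_i F i `<=` cell N 0 k.
  move=> x [i _]; rewrite /F /cell/= !in_itv/= => /andP[h1 h2].
  have [] := left_end_nested alpha01 N r (k * 2 ^ r + i).
  rewrite divnMDl ?expn_gt0// divn_small// addn0 -/n => h3 h4.
  by apply/andP; split; lra.
have mF i : measurable (F i) by exact: measurable_cell.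
apply: (@le_trans _ _ (cantor_prob alpha n (\bigcup_i F i))); last first.
  apply: le_measure; rewrite ?inE//; last exact: measurable_cell.
  by apply: fin_bigcup_measurable => // ; exact: finite_finset.
have -> : cantor_prob alpha n (\bigcup_i F i) =
    (\sum_i cantor_prob alpha n (F i))%E.
  exact: measure_bigcup_fintype.
apply: (@le_trans _ _ (\sum_(i < 2 ^ r) ((2 ^ n)%:R^-1)%:E)%E); last first.
  by apply: lee_sum => i _; exact: cantor_prob_cell.
rewrite sumEFin sumr_const card_ord -(mulr_natl _ (2 ^ r)) /n expnD natrM.
rewrite invfM mulrCA divff ?mulr1// pnatr_eq0 -lt0n expn_gt0//.
Qed.

(** Each of the 2 ^ N cells has mass at least 2 ^- N, and they are disjoint, so
    there is no room for more. *)
Lemma cantor_uniform_cell (mu : probability T R) N :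
  cantor_uniform alpha mu ->
  exists2 g, 0 < g & forall e, 0 < e < g ->
    trivIset setT (fun k : 'I_(2 ^ N) => cell N e k) /\
    forall k : 'I_(2 ^ N), mu (cell N e k) = ((2 ^ N)%:R^-1)%:E.
Proof.
move=> mu_unif; have [g g0 hg] := trivIset_cell N.
exists g => // e /andP[e0 eg].
have tc := hg e (introT andP (conj (ltW e0) eg)); split=> //.
have lb (k : 'I_(2 ^ N)) : (((2 ^ N)%:R^-1)%:E <= mu (cell N e k))%E.
  apply: (@wasserstein_cvg_le _ (cantor_prob alpha) mu (cell N 0 k)
    (cell N e k) e _ N) => //.
  - exact: measurable_cell.
  - exact: measurable_cell.
  - move=> x y; rewrite /cell/= !in_itv/= ltr_distlC.
    by move=> /andP[? ?] /andP[? ?]; apply/andP; split; lra.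
  - by move=> n Nn; rewrite -(subnKC Nn); exact: cantor_prob_ancestor.
pose a (k : 'I_(2 ^ N)) := fine (mu (cell N e k)).
have aE (k : 'I_(2 ^ N)) : mu (cell N e k) = (a k)%:E.
  by rewrite fineK// fin_num_measure//; exact: measurable_cell.
have a0 (k : 'I_(2 ^ N)) : 0 <= a k - (2 ^ N)%:R^-1.
  by rewrite subr_ge0 -lee_fin -aE.
have sum0 : \sum_k (a k - (2 ^ N)%:R^-1) = 0.
  apply/eqP; rewrite eq_le; apply/andP; split; last exact: sumr_ge0.
  rewrite sumrB subr_le0 sumr_const card_ord -(mulr_natl (2 ^ N)%:R^-1).
  rewrite divff; last by rewrite pnatr_eq0 -lt0n expn_gt0.
  rewrite -lee_fin -sumEFin.
  rewrite (eq_bigr (fun k : 'I_(2 ^ N) => mu (cell N e k))); last first.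
    by move=> k _; rewrite aE.
  rewrite -[leLHS](measure_bigcup_fintype mu)//; last first.
    by move=> k; exact: measurable_cell.
  apply: probability_le1; apply: fin_bigcup_measurable.
    exact: finite_finset.
  by move=> k _; exact: measurable_cell.
move=> k; rewrite aE; congr EFin; apply/eqP; rewrite -subr_eq0; apply/eqP.
exact: (psumr_eq0P (P := xpredT) _ sum0).
Qed.

End uniform.

(** * The sliding involution and the main estimate *)

Section reflection.

(** Translation by m inside the blocks of M consecutive integers, upwards for
    the sign true and downwards for false. The sign is flipped by a move, so
    that moving again leads back; a pair that would leave its block does not
    move. *)
Definition slide (m M : nat) (z : nat * bool) : nat * bool :=
  if z.2 then
    if (z.1 %% M + m < M)%N then ((z.1 + m)%N, false) else z
  else
    if (m <= z.1 %% M)%N then ((z.1 - m)%N, true) else z.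

(** The pairs that slide cannot move. *)
Definition at_edge (m M : nat) (z : nat * bool) : bool :=
  if z.2 then (M <= z.1 %% M + m)%N else (z.1 %% M < m)%N.

Lemma modnD_small m M k :
  (k %% M + m < M)%N -> ((k + m) %% M = k %% M + m)%N.
Proof. by move=> h; rewrite -modnDml modn_small. Qed.

Lemma modnB_small m M k :
  (0 < M)%N -> (m <= k %% M)%N -> ((k - m) %% M = k %% M - m)%N.
Proof.
move=> M0 h; rewrite {1}(divn_eq k M) -addnBA// modnMDl modn_small//.
by apply: leq_ltn_trans (leq_subr _ _) _; rewrite ltn_mod.
Qed.

Lemma slideK m M : (0 < M)%N -> involutive (slide m M).
Proof.
move=> M0 [k []]; rewrite /slide /=.
- case: (ltnP (k %% M + m) M) => [h|/leq_gtF h] /=; last by rewrite h.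
  by rewrite modnD_small// leq_addl addnK.
- case: (leqP m (k %% M)) => [h|/ltn_geF h] /=; last by rewrite h.
  have mk : (m <= k)%N by apply: leq_trans h (leq_mod _ _).
  by rewrite modnB_small// subnK// ltn_mod M0 subnK.
Qed.

Lemma slide_lt m M Q z : (0 < M)%N -> (z.1 < Q * M)%N ->
  ((slide m M z).1 < Q * M)%N.
Proof.
case: z => k [] M0 kQ; rewrite /slide /=; case: ifP => h //=.
- rewrite (divn_eq k M) -addnA; apply: (@leq_trans ((k %/ M).+1 * M)).
    by rewrite mulSn addnC ltn_add2r.
  by rewrite leq_mul2r ltn_divLR// kQ orbT.
- exact: leq_ltn_trans (leq_subr _ _) kQ.
Qed.

Lemma sum_modn (f : nat -> nat) M Q : (0 < M)%N ->
  (\sum_(k < Q * M) f (k %% M) = Q * \sum_(i < M) f i)%N.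
Proof.
move=> M0; rewrite -(big_mkord xpredT (fun k => f (k %% M)%N)).
elim: Q => [|Q IH]; first by rewrite !mul0n big_geq.
rewrite (@big_cat_nat _ _ _ (Q * M)%N)//=; last first.
  by rewrite leq_mul2r leqnSn orbT.
rewrite IH [RHS]mulSnr; congr addn.
rewrite -{1}[(Q * M)%N]add0n big_addn mulSnr addKn big_mkord.
by apply: eq_bigr => i _; rewrite addnC modnMDl modn_small.
Qed.

(** In each block, m pairs of sign true are stuck at the upper end and m pairs of
    sign false at the lower end. *)
Lemma sum_at_edge m M Q : (0 < M)%N -> (m <= M)%N ->
  (\sum_(z : 'I_(Q * M) * bool) at_edge m M (z.1 : nat, z.2) = 2 * (Q * m))%N.
Proof.
move=> M0 mM.
rewrite -(pair_bigA _
  (fun (k : 'I_(Q * M)) b => at_edge m M (k : nat, b) : nat))/=.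
under eq_bigr do rewrite big_bool /at_edge /=.
rewrite big_split/= (sum_modn (fun i => (M <= i + m)%N : nat))//.
rewrite (sum_modn (fun i => (i < m)%N : nat))// -mulnDr.
have -> : (\sum_(i < M) (M <= i + m) = m)%N.
  suff -> K : (\sum_(i < K) (M <= i + m) = K - (M - m))%N by rewrite subKn.
  elim: K => [|K IH]; first by rewrite big_ord0.
  by rewrite big_ord_recr/= IH; lia.
have -> : (\sum_(i < M) (i < m) = m)%N.
  rewrite -[RHS](minn_idPr mM).
  elim: {mM M0}M => [|K IH]; first by rewrite big_ord0 min0n.
  by rewrite big_ord_recr/= IH; lia.
by rewrite addnn -mul2n mulnCA.
Qed.

End reflection.

Section estimate.
Context {R : realType}.
Local Notation T := (measurableTypeR R).
Variables (alpha : R^nat) (mu : probability T R).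
Hypothesis alpha01 : forall n, 0 < alpha n < 1.
Hypothesis alpha_nincr : nonincreasing_seq alpha.
Hypothesis mu_unif : cantor_uniform alpha mu.
Local Notation L := (left_end alpha).
Local Notation width := (width alpha).

(** A move by m inside a block of descendants is nearly a translation by
    (m / 2 ^ r) * width n. *)
Lemma left_end_slide n r m k : (k %% 2 ^ r + m < 2 ^ r)%N ->
  `|L (n + r) (k + m) - L (n + r) k - m%:R / 2 ^+ r * width n|
  <= 2 * (alpha n * width n).
Proof.
move=> km.
have := left_end_approx alpha01 alpha_nincr n r k.
have := left_end_approx alpha01 alpha_nincr n r (k + m).
rewrite modnD_small//.
have -> : ((k + m) %/ 2 ^ r = k %/ 2 ^ r)%N.
  rewrite {1}(divn_eq k (2 ^ r)) -addnA divnMDl ?expn_gt0//.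
  by rewrite (divn_small km) addn0.
rewrite natrD !ler_norml 2!mulrDl.
by move=> /andP[? ?] /andP[? ?]; apply/andP; split; lra.
Qed.

(** In D, a part 2 * (alpha n * width n) is the deviation from the regular grid;
    the rest absorbs the width of the cells and the rounding of m, both
    negligible when r is large. *)
Lemma wasserstein_split_estimate n h p D : 0 < h <= width n -> 0 < p ->
  D = 3 * (alpha n * width n) ->
  (wasserstein p mu (split_measure mu h) <=
   ((D `^ p + h / width n * (h + D) `^ p) `^ p^-1)%:E)%E.
Proof.
move=> /andP[h0 hn] p0 DE.
have d0 := width_gt0 alpha01 n; have /andP[a0 a1] := alpha01 n.
have ad0 : 0 < alpha n * width n by rewrite mulr_gt0.
have D0 : 0 < D by rewrite DE mulr_gt0.
(* alpha n * width n / 4 then bounds the length of the intervals of level n + r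
   and the rounding error in m *)
have [r hr] : exists r, (2 ^+ r)^-1 <= alpha n / 4.
  have h1 : `|2^-1| < 1 :> R by rewrite ger0_norm// invf_lt1// ltr1n.
  have a4 : 0 < alpha n / 4 by rewrite divr_gt0.
  have /cvgrPdist_lt/(_ _ a4)[r _ /(_ r (leqnn r))] := cvg_expr h1.
  by rewrite sub0r normrN ger0_norm ?exprn_ge0// exprVn => /ltW; exists r.
set M := (2 ^ r)%N; set N := (n + r)%N.
have M0 : (0 < M)%N by rewrite expn_gt0.
have QM : (2 ^ N = 2 ^ n * M)%N by rewrite /N expnD.
have Mr : M%:R = 2 ^+ r :> R by rewrite natrX.
have Mr0 : 0 < M%:R :> R by rewrite ltr0n.
pose m := Num.truncn (h * M%:R / width n).
have /andP[m1 m2] : m%:R <= h * M%:R / width n < m.+1%:R.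
  by apply: truncn_itv; rewrite divr_ge0 ?mulr_ge0 ?ler0n// ltW.
have mM : (m <= M)%N.
  rewrite -(ler_nat R); apply: le_trans m1 _.
  by rewrite ler_pdivrMr// mulrC ler_wpM2l// ltW.
have mh : m%:R / M%:R * width n <= h <=
    m%:R / M%:R * width n + width n / M%:R.
  have -> : m%:R / M%:R * width n = m%:R * (width n / M%:R) by ring.
  have hE : h = h * M%:R / width n * (width n / M%:R).
    by field; rewrite !lt0r_neq0.
  have dM0 : 0 < width n / M%:R by rewrite divr_gt0.
  rewrite [X in _ <= X <= _]hE ler_pM2r// m1/=.
  apply: (@le_trans _ _ (m.+1%:R * (width n / M%:R))).
    by rewrite ler_pM2r// ltW.
  by rewrite -natr1 mulrDl mul1r.
have [g g0 hg] := cantor_uniform_cell alpha01 N mu_unif.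
pose e := Num.min (g / 2) (alpha n * width n / 4).
have e0 : 0 < e by rewrite lt_min !divr_gt0.
have eg : e < g.
  by apply: (@le_lt_trans _ _ (g / 2)); [rewrite ge_min lexx|lra].
have ea : e <= alpha n * width n / 4 by rewrite ge_min lexx orbT.
have [tJ muJ] := hg e (introT andP (conj e0 eg)).
pose I := 'I_(2 ^ N).
pose zn (z : I * bool) : nat * bool := (z.1 : nat, z.2).
pose F (z : I * bool) : I * bool :=
  (insubd z.1 (slide m M (zn z)).1, (slide m M (zn z)).2).
have FE z : zn (F z) = slide m M (zn z).
  have lt : ((slide m M (zn z)).1 < 2 ^ N)%N.
    by rewrite QM slide_lt// -QM; exact: ltn_ord.
  by rewrite {1}/zn /F /= insubdK//; case: (slide _ _ _).
have injF : injective F.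
  move=> z1 z2 /(congr1 zn); rewrite !FE => /(inv_inj (slideK m M0)).
  by case: z1 z2 => [i1 b1] [i2 b2] [/val_inj -> ->].
(* a pair at the edge keeps its cell, where the shift by h is paid in full *)
pose Dz (z : I * bool) : R := if at_edge m M (zn z) then h + D else D.
have rnd : width n / M%:R <= alpha n * width n / 4.
  by rewrite Mr mulrC mulrAC ler_pM2r.
have lenN : width N <= alpha n * width n / 4.
  by apply: le_trans rnd; rewrite Mr; exact: width_addn.
have key (x y : R) (z : I * bool) : cell alpha N e z.1 x ->
    cell alpha N e (F z).1 y -> `|x - (y + signed_shift h (F z).2)| <= Dz z.
  have <- : (zn (F z)).1 = (F z).1 by [].
  have -> : (F z).2 = (zn (F z)).2 by [].
  rewrite FE /Dz; case: z => k b; rewrite /zn /=.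
  rewrite /cell /= !in_itv /= => /andP[x1 x2].
  have same b' (y' : R) : L N k - e <= y' <= L N k + width N + e ->
      `|x - (y' + signed_shift h b')| <= h + D.
    move=> /andP[y1 y2]; rewrite ler_norml DE.
    by case: b'; rewrite /signed_shift; apply/andP; split; lra.
  case: b; rewrite /slide /at_edge /=.
  - rewrite (leqNgt M); case: ifP => km /=; last exact: (same true).
    move=> /andP[y1 y2].
    have := left_end_slide n km; rewrite -/N -Mr DE !ler_norml => /andP[k1 k2].
    case/andP: mh => mh1 mh2.
    by apply/andP; split; lra.
  - rewrite ltnNge; case: ifP => km /=; last exact: (same false).
    move=> /andP[y1 y2].
    have mk : (m <= k)%N by apply: leq_trans km (leq_mod _ _).
    have km' : ((k - m) %% 2 ^ r + m < 2 ^ r)%N.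
      by rewrite modnB_small// subnK// ltn_mod.
    have := left_end_slide n km'; rewrite subnK// -/N -Mr DE !ler_norml.
    move=> /andP[k1 k2].
    case/andP: mh => mh1 mh2.
    by apply/andP; split; lra.
have Dz0 z : 0 <= Dz z.
  by rewrite /Dz; case: ifP => _; [rewrite addr_ge0// ltW|rewrite ltW].
have i0 : I by apply: (@Ordinal _ 0); rewrite expn_gt0.
have cardI : #|{: I}| = (2 ^ N)%N by rewrite card_ord.
apply: (@le_trans _ _ (((\sum_z Dz z `^ p) / (#|{: I}| * 2)%:R) `^ p^-1)%:E).
  apply: (wasserstein_split_le (J := fun k : I => cell alpha N e k)
    _ tJ _ i0 injF p0 Dz0).
  - by move=> i; exact: measurable_cell.
  - by move=> i; rewrite cardI.
  - by move=> z x y Jx Jy; exact: key Jx Jy.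
rewrite lee_fin; apply: ge0_ler_powR.
- by rewrite invr_ge0 ltW.
- rewrite nnegrE divr_ge0//; apply: sumr_ge0 => z _; exact: powR_ge0.
- rewrite nnegrE addr_ge0 ?powR_ge0// mulr_ge0 ?powR_ge0//.
  by rewrite divr_ge0// ltW.
have DzE z : Dz z `^ p <= D `^ p + (at_edge m M (zn z))%:R * (h + D) `^ p.
  rewrite /Dz; case: ifP => _; last by rewrite mul0r addr0.
  by rewrite mul1r lerDr powR_ge0.
rewrite ler_pdivrMr ?cardI ?ltr0n ?muln_gt0 ?expn_gt0//.
apply: (@le_trans _ _
    (\sum_z (D `^ p + (at_edge m M (zn z))%:R * (h + D) `^ p))).
  exact: ler_sum.
rewrite big_split/= sumr_const -mulr_suml -natr_sum.
have -> : (\sum_(z : I * bool) at_edge m M (zn z) = 2 * (2 ^ n * m))%N.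
  by have := sum_at_edge (2 ^ n) M0 mM; rewrite -QM.
rewrite card_prod card_bool cardI -(mulr_natr (D `^ p)) mulrDl lerD2l.
rewrite mulrAC ler_wpM2r ?powR_ge0// QM !natrM.
have -> : h / width n * ((2 ^ n)%:R * M%:R * 2) =
    2 * ((2 ^ n)%:R * (h * M%:R / width n)) by ring.
by rewrite !ler_wpM2l.
Qed.

End estimate.

(** * Choice of the level *)

Section scales.
Context {R : realType}.
Variable alpha : R^nat.
Hypothesis alpha01 : forall n, 0 < alpha n < 1.
Hypothesis alpha_nincr : nonincreasing_seq alpha.
Local Notation width := (width alpha).

Lemma width_cvg0 : width @ \oo --> 0.
Proof.
apply: (@squeeze_cvgr _ _ _ _ (cst 0) (GRing.exp (2^-1 : R))).
- apply: nearW => n; rewrite ltW ?width_gt0//= exprVn.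
  by apply: le_trans (width_addn alpha01 0 n) _; rewrite mul1r.
- exact: cvg_cst.
- by apply: cvg_expr; rewrite ger0_norm// invf_lt1// ltr1n.
Qed.

(** The lengths of consecutive levels have ratio at least (1 - alpha 0) / 2, so
    some level has length x up to the constant 2 / (1 - alpha 0). *)
Lemma width_scale n0 x : 0 < x <= width n0 ->
  exists2 n, (n0 <= n)%N & x <= width n <= 2 / (1 - alpha 0) * x.
Proof.
move=> /andP[x0 xn0].
have ex : exists n, width n < x.
  have /cvgrPdist_lt/(_ _ x0)[n _ /(_ n (leqnn n))] := width_cvg0.
  by rewrite /= sub0r normrN gtr0_norm ?width_gt0// => ?; exists n.
have [m mx mmin] := ex_minnP ex.
have mono k l : (k <= l)%N -> width l <= width k.
  move=> kl; rewrite -(subnKC kl); apply: (le_trans (width_addn alpha01 _ _)).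
  rewrite ler_pdivrMr ?exprn_gt0// ler_peMr ?exprn_ege1// ?ler1n//.
  exact/ltW/width_gt0.
have n0m : (n0 < m)%N.
  by rewrite ltnNge; apply/negP => /mono ?; lra.
case: m mx mmin n0m => // m mx mmin n0m; exists m => //.
have xm : x <= width m.
  by rewrite leNgt; apply/negP => /mmin; rewrite ltnn.
rewrite xm /=.
have /andP[a0 a1] := alpha01 0; have lm := width_gt0 alpha01 m.
have am : alpha m <= alpha 0 by exact: alpha_nincr.
rewrite mulrAC ler_pdivlMr ?subr_gt0//.
by move: mx => /=; nra.
Qed.

End scales.

Theorem proposition14 (R : realType) (alpha : R^nat)
    (mu : probability (measurableTypeR R) R) (p : R)
    (alpha01 : forall n, 0 < alpha n < 1)
    (alpha_nincr : nonincreasing_seq alpha)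
    (mu_unif : cantor_uniform alpha mu)
    (alpha0 : alpha @ \oo --> 0)
    (p1 : 1 <= p) :
  limf_esup (fun h : R => wasserstein p mu (split_measure mu h) * (h^-1)%:E)%E
    0^'+ = 0%E.
Proof.
have p0 : 0 < p by lra.
set f := fun h : R => _.
apply/eqP; rewrite eq_le; apply/andP; split; last first.
  apply: le_ereal_inf_tmp => _ [A /= A0 <-].
  have : \forall h \near 0^'+, A h /\ 0 < h.
    by near=> h; split; near: h => //; exact: nbhs_right_gt.
  case/filter_ex => h [Ah h0].
  apply: le_ereal_sup_tmp; exists (f h); first by exists h.
  by rewrite /f mule_ge0 ?poweR_ge0// lee_fin invr_ge0 ltW.
apply/lee_addgt0Pr => e e0; rewrite add0e.
have ep0 : 0 < e `^ p by rewrite powR_gt0.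
have two0 : 0 < 2 `^ p :> R by rewrite powR_gt0.
(* K makes the boundary layer, of mass at most K^-1, contribute at most half of
   (e * h) `^ p *)
pose K := 1 + 2 * 2 `^ p / e `^ p.
have K1 : 1 <= K by rewrite lerDl divr_ge0 ?mulr_ge0 ?powR_ge0.
have K0 : 0 < K by lra.
have Ke : 2 `^ p / K <= e `^ p / 2.
  rewrite ler_pdivrMr// /K mulrDr mulr1.
  have -> : e `^ p / 2 * (2 * 2 `^ p / e `^ p) = 2 `^ p.
    by field; rewrite lt0r_neq0.
  by lra.
have /andP[a0 a1] := alpha01 0.
pose A := 2 / (1 - alpha 0) * K.
have A0 : 0 < A.
  by apply: mulr_gt0 => //; apply: divr_gt0 => //; rewrite subr_gt0.
(* t bounds D / h: the other half is left to D `^ p <= t `^ p * h `^ p, where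
   t `^ p <= t as t <= 1 *)
pose t := Num.min 1 (e `^ p / 2).
have t0 : 0 < t by rewrite lt_min ltr01 divr_gt0.
have t1 : t <= 1 by rewrite ge_min lexx.
have te : t <= e `^ p / 2 by rewrite ge_min lexx orbT.
have A3 : 0 < 3 * A by lra.
have tA0 : 0 < t / (3 * A) by exact: divr_gt0.
have /cvgrPdist_lt/(_ _ tA0)[n0 _ hn0] := alpha0.
have {}hn0 n : (n0 <= n)%N -> 3 * (alpha n * A) <= t.
  move=> /hn0; rewrite /= sub0r normrN gtr0_norm; last first.
    by case/andP: (alpha01 n).
  by rewrite ltr_pdivlMr// => /ltW; rewrite mulrCA.
have fe h : 0 < h -> h <= width alpha n0 / K -> (f h <= e%:E)%E.
  move=> h0; rewrite ler_pdivlMr// => hK.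
  have hK0 : 0 < h * K by rewrite mulr_gt0.
  have [n nn0 /andP[n1 n2]] : exists2 n, (n0 <= n)%N &
      h * K <= width alpha n <= 2 / (1 - alpha 0) * (h * K).
    by apply: width_scale => //; rewrite hK0.
  have d0 := width_gt0 alpha01 n; have /andP[an0 an1] := alpha01 n.
  have hn : 0 < h <= width alpha n.
    by rewrite h0/=; apply: le_trans n1; rewrite ler_peMr// ltW.
  have [D DE] : exists D, D = 3 * (alpha n * width alpha n) by eexists.
  have D0 : 0 <= D.
    by rewrite DE; apply: mulr_ge0 => //; apply: mulr_ge0; exact: ltW.
  have Dt : D <= t * h.
    apply: (@le_trans _ _ (3 * (alpha n * A) * h)).
      have lA : width alpha n <= A * h.
        by rewrite (_ : A * h = 2 / (1 - alpha 0) * (h * K))// /A; ring.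
      have : alpha n * width alpha n <= alpha n * (A * h) by rewrite ler_pM2l.
      rewrite DE; lra.
    by rewrite ler_wpM2r ?hn0// ltW.
  have est := wasserstein_split_estimate alpha01 alpha_nincr mu_unif hn p0 DE.
  have h0' := ltW h0; have t0' := ltW t0; have e0' := ltW e0.
  have p0' := ltW p0; have d0' := ltW d0.
  have hp0 : 0 <= h `^ p by exact: powR_ge0.
  have b1 : D `^ p <= t * h `^ p.
    apply: (@le_trans _ _ ((t * h) `^ p)).
      by apply: ge0_ler_powR => //; rewrite ?nnegrE// ?mulr_ge0 ?ltW.
    rewrite powRM// ler_wpM2r//.
    rewrite -[leRHS]powRr1//.
    by apply: ger_powR => //; rewrite t0.
  have b2 : h / width alpha n <= K^-1.
    by rewrite ler_pdivrMr// mulrC ler_pdivlMr.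
  have b3 : (h + D) `^ p <= 2 `^ p * h `^ p.
    have hD : h + D <= 2 * h.
      have : t * h <= 1 * h by rewrite ler_wpM2r.
      by move: Dt; lra.
    by rewrite -powRM//; apply: ge0_ler_powR => //; rewrite nnegrE; lra.
  have b4 : h / width alpha n * (h + D) `^ p <= e `^ p / 2 * h `^ p.
    apply: (@le_trans _ _ (K^-1 * (2 `^ p * h `^ p))).
      by apply: ler_pM => //; [exact: divr_ge0|exact: powR_ge0].
    by rewrite mulrA ler_wpM2r// mulrC.
  have b5 : D `^ p + h / width alpha n * (h + D) `^ p <= (e * h) `^ p.
    rewrite powRM//.
    have : t * h `^ p <= e `^ p / 2 * h `^ p by rewrite ler_wpM2r.
    lra.
  rewrite /f lee_pdivrMr//; apply: (le_trans est).
  rewrite -EFinM lee_fin.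
  have eh0 : 0 <= e * h by exact: mulr_ge0.
  rewrite -[leRHS]powRr1// -(divff (lt0r_neq0 p0)) powRrM.
  apply: ge0_ler_powR => //; rewrite ?invr_ge0 ?nnegrE ?powR_ge0//.
  apply: addr_ge0; first exact: powR_ge0.
  by apply: mulr_ge0; [exact: divr_ge0|exact: powR_ge0].
have L0 : 0 < width alpha n0 / K by rewrite divr_gt0// width_gt0.
apply: ge_ereal_inf.
exists (ereal_sup (f @` [set h | 0 < h <= width alpha n0 / K])).
  exists [set h | 0 < h <= width alpha n0 / K] => //.
  near=> h; apply/andP; split; near: h; first exact: nbhs_right_gt.
  exact: nbhs_right_le.
by apply: ge_ereal_sup => _ [h /= /andP[h0 hL] <-]; exact: fe.
Unshelve. all: end_near. Qed.
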